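(* Let $F$ be a number field Galois over $\mathbb Q$, $M$ an even integer divisible by the discriminant of $F$, $n\ge1$, $i\mapsto\sigma_i\in\mathrm{Gal}(F/\mathbb Q)$ ($i=1,\dots,n$, $\sigma_1=\mathrm{id}$) a vertical gauge, $p$ a prime not dividing $M$, $\mathfrak P$ a prime of $\mathcal O_F$ dividing $p$, and $q=(q_{jk})\in GL_n(\mathcal O_F[1/M])$ with $q^t=q$. Let $(\delta^1,\dots,\delta^n)$ be the vertical Levi-Civita connection attached to $q$ at $\mathfrak P$, with Christoffel symbols $\gamma_i=(\gamma_{ijk})$ relative to $q$. Let $$C_i=(C_{ijk})_{j,k}:=-x^{(p)t}\cdot\sigma_i^{-1}\delta^iq\cdot x^{(p)}+\frac1p\left\{(x^t\cdot\sigma_i^{-1}q\cdot x)^{(p)}-x^{(p)t}\cdot\sigma_i^{-1}q^{(p)}\cdot x^{(p)}\right\}.$$ Then for all $i,j,k=1,\dots,n$ the following congruences hold in $\mathcal O(\widehat{G^1})$: $$\sigma_i^{-1}\gamma_{ijk}\equiv\tfrac12(C_{ijk}+C_{jik}-C_{kij})\quad\text{mod } p,$$ $$\sigma_i^{-1}\gamma_{ijk}\equiv-\tfrac12(\sigma_i^{-1}\delta^iq_{jk}+\sigma_j^{-1}\delta^jq_{ik}-\sigma_k^{-1}\delta^kq_{ij})\quad\text{mod }(p,x-1),$$ where $(p,x-1)$ is the ideal generated by $p$, the $x_{ii}-1$, and the $x_{ij}$ for $i\ne j$.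
   Context: For a matrix $a=(a_{ij})$, $a^t$ is the transpose and $a^{(p)}=(a_{ij}^p)$; set maps between rings are applied to matrices entrywise. A Frobenius lift on a ring $A$ is a ring endomorphism reducing mod $p$ to the $p$-power Frobenius of $A/pA$. On a $p$-torsion free ring a $p$-derivation $\delta$ is the same as a Frobenius lift $\phi$, via $\phi(a)=a^p+p\,\delta a$ (''attached''). $\widehat{\ }$ denotes $p$-adic completion. Set $\mathfrak P_i=\sigma_i\mathfrak P$ and let $R_i=\widehat{\mathcal O_{\mathfrak P_i}}$ be the $p$-adic completion of the localization of $\mathcal O_F$ at $\mathfrak P_i$ (a complete discrete valuation ring with maximal ideal generated by the odd prime $p$). It has a unique Frobenius lift $\phi^i$, hence a unique $p$-derivation $\delta^i$. Let $x$ be an $n\times n$ matrix of indeterminates, $G^i=\mathrm{Spec}\,R_i[x,\det(x)^{-1}]$, $\mathcal O(\widehat{G^i})=R_i[x,\det(x)^{-1}]^{\widehat{\ }}$. The automorphism $\sigma_i$ induces an isomorphism $R_1\to R_i$, extended to $\sigma_i:\mathcal O(\widehat{G^1})\to\mathcal O(\widehat{G^i})$ by $\sigma_i(x)=x$. A vertical connection at $\mathfrak P$ is an $n$-tuple $(\delta^1,\dots,\delta^n)$ where $\delta^i$ is a $p$-derivation on $\mathcal O(\widehat{G^i})$ extending that of $R_i$ (same notation), with attached Frobenius lift $\phi^i$. It is metric with respect to $q$ if for every $i$, $\phi^i\circ\mathcal H_q=\mathcal H_q\circ\phi^i_0$, where $\mathcal H_q$ is the (continuous) $R_i$-algebra endomorphism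 of $\mathcal O(\widehat{G^i})$ with $x\mapsto x^tqx$ and $\phi_0^i$ is the Frobenius lift extending that of $R_i$ with $\phi_0^i(x)=x^{(p)}$. Its Christoffel symbols relative to $q$ are $\gamma_i=(\gamma_{ijk})_{j,k}:=(\delta^ix)^t\cdot\phi^i(q)\cdot x^{(p)}$, and it is torsion free if $\sigma_i^{-1}\gamma_{ijk}=\sigma_j^{-1}\gamma_{jik}$ for all $i,j,k$. The vertical Levi-Civita connection attached to $q$ at $\mathfrak P$ is the unique (it exists) vertical connection that is metric with respect to $q$ and torsion free relative to $q$. *)

(* Defs.v *)
From HB Require Import structures.
From mathcomp Require Import all_boot all_order all_algebra all_fingroup all_field.
From mathcomp Require Import boolp classical_sets.
From mathcomp Require Import generic_quotient mpoly.

Set Implicit Arguments.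
Unset Strict Implicit.
Unset Printing Implicit Defensive.

Import GRing.Theory.
Local Open Scope ring_scope.
Local Open Scope quotient_scope.

(* [pquot a] is A / aA, possibly the zero ring. *)
Section PrincipalQuotient.
Variables (A : comPzRingType) (a : A).

Definition principal : {pred A} := fun x => `[< exists z, x = a * z >].

Lemma principalP x : reflect (exists z, x = a * z) (x \in principal).
Proof. exact: asboolP. Qed.

Lemma principal_zmod : zmod_closed principal.
Proof.
split=> [|_ _ /principalP[x ->] /principalP[y ->]]; apply/principalP.
  by exists 0; rewrite mulr0.
by exists (x - y); rewrite mulrBr.
Qed.

HB.instance Definition _ := GRing.isZmodClosed.Build A principal principal_zmod.

Definition pquot : Type := {ideal_quot principal}.

HB.instance Definition _ := GRing.Zmodule.on pquot.
HB.instance Definition _ := EqQuotient.on pquot.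

Definition proj (x : A) : pquot := \pi_pquot x.

Lemma projP x y : proj x = proj y <-> exists z, x - y = a * z.
Proof.
rewrite /proj; split=> [/eqP|/principalP xy]; last apply/eqP.
  by rewrite -Quotient.idealrBE => /principalP.
by rewrite -Quotient.idealrBE.
Qed.

Lemma repr_proj (u : pquot) : proj (repr u) = u.
Proof. exact: reprK. Qed.

Definition pquot_one : pquot := proj 1.
Definition pquot_mul (u v : pquot) : pquot := proj (repr u * repr v).

Lemma projB x y : proj (x - y) = proj x - proj y.
Proof. by rewrite /proj !piE. Qed.
Lemma projD x y : proj (x + y) = proj x + proj y.
Proof. by rewrite /proj !piE. Qed.

Lemma projM x y : proj (x * y) = pquot_mul (proj x) (proj y).
Proof.
apply/projP.
have /projP[u hu] := repr_proj (proj x); have /projP[v hv] := repr_proj (proj y).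
exists (- (u * repr (proj y) + x * v)).
rewrite mulrN mulrDr mulrA -hu mulrCA -hv mulrBl mulrBr.
by rewrite addrA subrK opprB.
Qed.

Fact pquot_mulA : associative pquot_mul.
Proof.
move=> u v w; rewrite -[u]repr_proj -[v]repr_proj -[w]repr_proj.
by rewrite -!projM mulrA.
Qed.
Fact pquot_mulC : commutative pquot_mul.
Proof. by move=> u v; rewrite /pquot_mul mulrC. Qed.
Fact pquot_mul1 : left_id pquot_one pquot_mul.
Proof. by move=> u; rewrite -[u]repr_proj -projM mul1r. Qed.
Fact pquot_mulD : left_distributive pquot_mul +%R.
Proof.
move=> u v w; rewrite -[u]repr_proj -[v]repr_proj -[w]repr_proj.
by rewrite -projD -!projM mulrDl projD.
Qed.

HB.instance Definition _ := GRing.Zmodule_isComPzRing.Build pquot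
  pquot_mulA pquot_mulC pquot_mul1 pquot_mulD.

Fact proj_is_zmod : zmod_morphism proj. Proof. exact: projB. Qed.
Fact proj_is_monoid : monoid_morphism proj. Proof. by split=> // x y; exact: projM. Qed.
HB.instance Definition _ := GRing.isZmodMorphism.Build A pquot proj proj_is_zmod.
HB.instance Definition _ := GRing.isMonoidMorphism.Build A pquot proj proj_is_monoid.

End PrincipalQuotient.

(* lim_n A / p^n A, as coherent families of residues. *)
Section Completion.
Variables (A : comPzRingType) (p : nat).

Definition transition n (u : pquot (p%:R ^+ n.+1 : A)) : pquot (p%:R ^+ n : A) :=
  proj _ (repr u).

Record completion : Type := Completion {
  component :> forall n, pquot (p%:R ^+ n : A);
  componentP : forall n, transition (component n.+1) = component n }.

HB.instance Definition _ := gen_eqMixin completion.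
HB.instance Definition _ := gen_choiceMixin completion.

Lemma completion_eq (u v : completion) : (forall n, u n = v n) -> u = v.
Proof.
case: u v => [u hu] [v hv] /= uv.
have {}uv : u = v by apply: functional_extensionality_dep.
by subst v; congr Completion; apply: Prop_irrelevance.
Qed.

Lemma transition_proj n x : transition (proj (p%:R ^+ n.+1) x) = proj _ x.
Proof.
apply/projP; have /projP[z hz] := repr_proj (proj (p%:R ^+ n.+1) x).
by exists (p%:R * z); rewrite hz exprSr mulrA.
Qed.

Lemma transitionD n (u v : pquot (p%:R ^+ n.+1 : A)) :
  transition (u + v) = transition u + transition v.
Proof.
rewrite -[u]repr_proj -[v]repr_proj -rmorphD /=.
by rewrite !transition_proj rmorphD.
Qed.
Lemma transitionM n (u v : pquot (p%:R ^+ n.+1 : A)) :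
  transition (u * v) = transition u * transition v.
Proof.
rewrite -[u]repr_proj -[v]repr_proj -rmorphM /=.
by rewrite !transition_proj rmorphM.
Qed.
Lemma transitionN n (u : pquot (p%:R ^+ n.+1 : A)) :
  transition (- u) = - transition u.
Proof. by rewrite -[u]repr_proj -rmorphN /= !transition_proj rmorphN. Qed.

Fact to_completion_subproof (x : A) n :
  transition (proj (p%:R ^+ n.+1) x) = proj _ x.
Proof. exact: transition_proj. Qed.
Definition to_completion x := Completion (to_completion_subproof x).

Fact cadd_subproof (u v : completion) n :
  transition (u n.+1 + v n.+1) = u n + v n.
Proof. by rewrite transitionD !componentP. Qed.
Definition cadd u v := Completion (cadd_subproof u v).

Fact cmul_subproof (u v : completion) n :
  transition (u n.+1 * v n.+1) = u n * v n.
Proof. by rewrite transitionM !componentP. Qed.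
Definition cmul u v := Completion (cmul_subproof u v).

Fact copp_subproof (u : completion) n : transition (- u n.+1) = - u n.
Proof. by rewrite transitionN componentP. Qed.
Definition copp u := Completion (copp_subproof u).

Fact caddA : associative cadd.
Proof. by move=> u v w; apply: completion_eq => n /=; rewrite addrA. Qed.
Fact caddC : commutative cadd.
Proof. by move=> u v; apply: completion_eq => n /=; rewrite addrC. Qed.
Fact cadd0 : left_id (to_completion 0) cadd.
Proof. by move=> u; apply: completion_eq => n /=; rewrite rmorph0 add0r. Qed.
Fact caddN : left_inverse (to_completion 0) copp cadd.
Proof. by move=> u; apply: completion_eq => n /=; rewrite rmorph0 addNr. Qed.

HB.instance Definition _ := GRing.isZmodule.Build completion caddA caddC cadd0 caddN.

Fact cmulA : associative cmul.
Proof. by move=> u v w; apply: completion_eq => n /=; rewrite mulrA. Qed.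
Fact cmulC : commutative cmul.
Proof. by move=> u v; apply: completion_eq => n /=; rewrite mulrC. Qed.
Fact cmul1 : left_id (to_completion 1) cmul.
Proof. by move=> u; apply: completion_eq => n /=; rewrite rmorph1 mul1r. Qed.
Fact cmulD : left_distributive cmul cadd.
Proof. by move=> u v w; apply: completion_eq => n /=; rewrite mulrDl. Qed.

HB.instance Definition _ := GRing.Zmodule_isComPzRing.Build completion
  cmulA cmulC cmul1 cmulD.

Fact to_completion_zmod : zmod_morphism to_completion.
Proof. by move=> x y; apply: completion_eq => n /=; rewrite rmorphB. Qed.
Fact to_completion_monoid : monoid_morphism to_completion.
Proof.
by split=> [//|x y]; apply: completion_eq => n /=; rewrite rmorphM.
Qed.
HB.instance Definition _ :=
  GRing.isZmodMorphism.Build A completion to_completion to_completion_zmod.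
HB.instance Definition _ :=
  GRing.isMonoidMorphism.Build A completion to_completion to_completion_monoid.

End Completion.

(* p-derivations and Frobenius lifts. On p-torsion free rings, the only ones
   considered below, p-derivations are the maps [d] such that
   a |-> a ^ p + p (d a) is a ring endomorphism. *)
Section PDerivations.
Variable p : nat.

Definition ring_morphism (A B : pzRingType) (f : A -> B) :=
  zmod_morphism f /\ monoid_morphism f.

Definition frobenius_lift (A : comPzRingType) (f : A -> A) :=
  ring_morphism f /\ forall a, exists b, f a = a ^+ p + p%:R * b.

Definition attached (A : comPzRingType) (d : A -> A) (a : A) : A :=
  a ^+ p + p%:R * d a.

Definition pderivation (A : comPzRingType) (d : A -> A) :=
  frobenius_lift (attached d).

Definition mxfrob (A : comPzRingType) m n (a : 'M[A]_(m, n)) : 'M[A]_(m, n) :=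
  map_mx (fun c => c ^+ p) a.

(* y / p, which is unique in a p-torsion free ring; 0 if p does not divide y. *)
Definition divp (A : comPzRingType) (y : A) : A :=
  xget 0 [set z | p%:R * z = y]%classic.

Definition congr_p (A : comPzRingType) (u v : A) :=
  exists w, u - v = p%:R * w.

(* Congruence modulo the ideal generated by p and the entries of a matrix. *)
Definition congr_p_mx (A : comPzRingType) n (y : 'M[A]_n) (u v : A) :=
  exists (w : A) (W : 'M[A]_n),
    u - v = p%:R * w + \sum_j \sum_k W j k * y j k.

End PDerivations.

Section NumberField.
Variable F : splittingFieldType rat.

Definition integral (a : F) : Prop := integralOver (intmul 1 : int -> F) a.

(* a belongs to O_F[1/M] *)
Definition integral_away (M : int) (a : F) : Prop :=
  exists k, integral (M%:~R ^+ k * a).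

Definition GL_integral_away (M : int) n (q : 'M[F]_n) : Prop :=
  [/\ q \in unitmx, forall j k, integral_away M (q j k) &
      forall j k, integral_away M (invmx q j k)].

Definition integral_basis d (w : 'I_d -> F) : Prop :=
  (forall i, integral (w i)) /\
  forall a, integral a ->
    exists! c : {ffun 'I_d -> int}, a = \sum_i (c i)%:~R * w i.

Definition discriminant (D : int) : Prop :=
  exists w : 'I_(\dim {:F}) -> F, integral_basis w /\
    D%:~R = \det (\matrix_(i, j) galTrace 1 {:F} (w i * w j)).

(* Prime ideals of O_F containing p, as sets of elements of F. *)
Record prime_over (p : nat) := PrimeOver {
  prime_set :> F -> Prop;
  prime_int : forall a, prime_set a -> integral a;
  prime0 : prime_set 0;
  primeD : forall a b, prime_set a -> prime_set b -> prime_set (a + b);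
  primeMl : forall a b, integral a -> prime_set b -> prime_set (a * b);
  prime1 : ~ prime_set 1;
  primeM : forall a b, integral a -> integral b ->
    prime_set (a * b) -> prime_set a \/ prime_set b;
  prime_above : prime_set p%:R }.

Lemma integral_gal (s : gal_of {:F}) a : integral a -> integral (s a).
Proof.
move=> /(integral_rmorph s) ha; rewrite /integral.
suff -> : (intmul 1 : int -> F) = s \o intmul 1 by [].
by apply/funext => z /=; rewrite rmorph_int.
Qed.

Lemma galV_K (s : gal_of {:F}) a : s ((s^-1)%g a) = a.
Proof. by rewrite -galM ?memvf // mulVg gal_id. Qed.
Lemma gal_VK (s : gal_of {:F}) a : (s^-1)%g (s a) = a.
Proof. by rewrite -galM ?memvf // mulgV gal_id. Qed.

Section PrimeImage.
Variables (p : nat) (s : gal_of {:F}) (P : prime_over p).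

Definition image_set (a : F) : Prop := exists2 b, P b & a = s b.

Fact image_int a : image_set a -> integral a.
Proof. by case=> b /prime_int Pb ->; apply: integral_gal. Qed.
Fact image0 : image_set 0.
Proof. by exists 0; [exact: prime0 | rewrite rmorph0]. Qed.
Fact imageD a b : image_set a -> image_set b -> image_set (a + b).
Proof.
by case=> c Pc -> [d Pd ->]; exists (c + d); [exact: primeD | rewrite rmorphD].
Qed.
Fact imageMl a b : integral a -> image_set b -> image_set (a * b).
Proof.
move=> ia [d Pd ->]; exists ((s^-1)%g a * d).
  by apply: primeMl => //; apply: integral_gal.
by rewrite rmorphM /= galV_K.
Qed.
Fact image1 : ~ image_set 1.
Proof.
case=> b Pb h; have b1 : b = 1 by rewrite -(gal_VK s b) -h rmorph1.
by apply: (@prime1 p P); rewrite -b1.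
Qed.
Fact imageM a b : integral a -> integral b ->
  image_set (a * b) -> image_set a \/ image_set b.
Proof.
move=> ia ib [c Pc h].
have e : (s^-1)%g a * (s^-1)%g b = c by rewrite -(gal_VK s c) -h rmorphM.
have /= := @primeM p P ((s^-1)%g a) ((s^-1)%g b) (integral_gal _ ia) (integral_gal _ ib).
rewrite e => /(_ Pc).
by case=> ?; [left; exists ((s^-1)%g a) | right; exists ((s^-1)%g b)];
  rewrite ?galV_K.
Qed.
Fact image_above : image_set p%:R.
Proof. by exists p%:R; [exact: prime_above | rewrite rmorph_nat]. Qed.

Definition prime_image : prime_over p :=
  PrimeOver image_int image0 imageD imageMl image1 imageM image_above.

End PrimeImage.

Section LocalRing.
Variables (p : nat) (P : prime_over p).

(* Fractions b / c with b in O_F and c in O_F \ P. *)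
Definition in_local : {pred F} := fun a =>
  `[< exists b c, [/\ integral b, integral c, ~ P c & a = b / c] >].

Lemma notP_neq0 c : ~ P c -> c != 0.
Proof. by move=> h; apply/eqP => c0; apply: h; rewrite c0; exact: prime0. Qed.

Lemma notP_mul c d : integral c -> integral d -> ~ P c -> ~ P d -> ~ P (c * d).
Proof. by move=> ic id hc hd /(primeM ic id) []. Qed.

Lemma in_local_subring : subring_closed in_local.
Proof.
split.
- apply/asboolP; exists 1, 1; split; try exact: integral1.
    exact: prime1.
  by rewrite divr1.
- move=> _ _ /asboolP[b [c [ib ic hc ->]]] /asboolP[d [e [id ie he ->]]].
  apply/asboolP; exists (b * e - d * c), (c * e); split.
  + by apply: integral_sub; apply: integral_mul.
  + exact: integral_mul.
  + exact: notP_mul.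
  + by rewrite -mulNr addf_div ?mulNr ?notP_neq0.
- move=> _ _ /asboolP[b [c [ib ic hc ->]]] /asboolP[d [e [id ie he ->]]].
  apply/asboolP; exists (b * d), (c * e); split.
  + exact: integral_mul.
  + exact: integral_mul.
  + exact: notP_mul.
  + by rewrite mulf_div.
Qed.

HB.instance Definition _ :=
  GRing.isSubringClosed.Build F in_local in_local_subring.

Definition local_ring : Type := {a : F | a \in in_local}.

HB.instance Definition _ := [isSub of local_ring for @sval F _].
HB.instance Definition _ := [Choice of local_ring by <:].
HB.instance Definition _ := [SubChoice_isSubComNzRing of local_ring by <:].

(* Sends a to itself if a is in the localization, and to 0 otherwise; this is
   the inclusion on O_F[1/M] when p does not divide M. *)
Definition to_local (a : F) : local_ring := insubd 0 a.

Definition Rhat : Type := completion local_ring p.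

HB.instance Definition _ := GRing.ComPzRing.on Rhat.

Fact Rhat_neq0 : (1 : Rhat) != 0.
Proof.
apply/eqP => /(congr1 (fun u : completion _ _ => u 1%N)).
move=> /= /projP[z]; rewrite subr0 expr1 => /(congr1 val).
rewrite rmorphM rmorph1 rmorph_nat /=.
case: z => z /= /asboolP[b [c [ib ic hc ->]]] /esym.
have c0 := notP_neq0 hc.
rewrite mulrA => /(canRL (divfK c0)); rewrite mul1r => h.
by apply: hc; rewrite -h mulrC; apply: primeMl => //; exact: prime_above.
Qed.

HB.instance Definition _ := GRing.PzSemiRing_isNonZero.Build Rhat Rhat_neq0.

Definition to_Rhat (a : F) : Rhat := to_completion p (to_local a).

(* R[x, 1/det x], presented as R[x][T] / (T det x - 1). *)
Variable n : nat.

Definition xpoly : 'M[{mpoly Rhat[n * n]}]_n :=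
  \matrix_(j, k) 'X_(mxvec_index j k).

Definition OG : Type := pquot ('X * (\det xpoly)%:P - 1).
HB.instance Definition _ := GRing.ComPzRing.on OG.

Definition Ghat : Type := completion OG p.
HB.instance Definition _ := GRing.ComPzRing.on Ghat.

Definition const (a : Rhat) : Ghat := to_completion p (proj _ (a%:MP)%:P : OG).

Definition xhat : 'M[Ghat]_n :=
  map_mx (fun f => to_completion p (proj _ f%:P : OG)) xpoly.

End LocalRing.

End NumberField.

Arguments const {F p P} n.
Arguments xhat {F p} P n.

Section Maps.
Variables (F : splittingFieldType rat) (p n : nat).

(* There is at most one such h: ring homomorphisms between p-adically complete
   rings are continuous, and h is determined on R[x, 1/det x]. It exists
   whenever f is a ring homomorphism and det y is invertible. So [extension f y]
   is the continuous homomorphism extending f with x |-> y. *)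
Definition extends (P P' : prime_over F p) (f : Rhat P -> Ghat P' n)
    (y : 'M[Ghat P' n]_n) (h : Ghat P n -> Ghat P' n) : Prop :=
  [/\ ring_morphism h, forall a, h (const n a) = f a & map_mx h (xhat P n) = y].

Definition extension P P' (f : Rhat P -> Ghat P' n) (y : 'M[Ghat P' n]_n) :
    Ghat P n -> Ghat P' n :=
  xget (fun=> 0) [set h | extends f y h]%classic.

(* To be used when s P = P'; s then induces an isomorphism of localizations,
   hence of their completions. *)
Definition Rgal (s : gal_of {:F}) (P P' : prime_over F p) : Rhat P -> Rhat P' :=
  xget (fun=> 0) [set h | ring_morphism h /\
    forall a, a \in in_local P -> h (to_Rhat P a) = to_Rhat P' (s a)]%classic.

Definition Ggal (s : gal_of {:F}) (P P' : prime_over F p) :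
    Ghat P n -> Ghat P' n :=
  extension (const n \o @Rgal s P P') (xhat P' n).

Section Local.
Variable P : prime_over F p.

Definition qhat (q : 'M[F]_n) : 'M[Ghat P n]_n :=
  map_mx (const n \o to_Rhat P) q.

Definition half : Ghat P n := const n (to_Rhat P (2%:R)^-1).

Definition Hq (q : 'M[F]_n) : Ghat P n -> Ghat P n :=
  extension (@const F p P n) ((xhat P n)^T *m qhat q *m xhat P n).

Definition phi0 (d : Rhat P -> Rhat P) : Ghat P n -> Ghat P n :=
  xget (fun=> 0) [set h | frobenius_lift p h /\
    extends (const n \o attached p d) (mxfrob p (xhat P n)) h]%classic.

End Local.

End Maps.

Section Connections.
Variables (F : splittingFieldType rat) (p n : nat) (P : prime_over F p).
Variables (sigma : 'I_n -> gal_of {:F}) (q : 'M[F]_n).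

Definition vertical_gauge (n_gt0 : (0 < n)%N) : Prop :=
  (forall i, sigma i \in 'Gal({:F} / 1)%g) /\ sigma (Ordinal n_gt0) = 1%g.

Definition Pi (i : 'I_n) : prime_over F p := prime_image (sigma i) P.

(* The inverse of sigma_i : O(G^1)^ -> O(G^i)^ is induced by the inverse
   automorphism. The target is Ghat P since sigma_1 = id gives P_1 = P. *)
Definition sigma_inv (i : 'I_n) : Ghat (Pi i) n -> Ghat P n :=
  @Ggal F p n (sigma i)^-1%g (Pi i) P.

(* dR i stands for the p-derivation of R_i, which is unique. *)
Variable dR : forall i : 'I_n, Rhat (Pi i) -> Rhat (Pi i).
Variable delta : forall i : 'I_n, Ghat (Pi i) n -> Ghat (Pi i) n.
Arguments delta i _ : clear implicits.
Arguments dR i _ : clear implicits.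

Definition vertical_connection : Prop :=
  forall i, pderivation p (delta i) /\
            forall a, delta i (const n a) = const n (dR i a).

Definition metric : Prop :=
  forall i, attached p (delta i) \o Hq (P := Pi i) q =
            Hq (P := Pi i) q \o phi0 (n := n) (dR i).

Definition christoffel (i : 'I_n) : 'M[Ghat (Pi i) n]_n :=
  (map_mx (delta i) (xhat (Pi i) n))^T
    *m map_mx (attached p (delta i)) (qhat (Pi i) q)
    *m mxfrob p (xhat (Pi i) n).

Definition torsion_free : Prop :=
  forall i j k, sigma_inv (christoffel i j k) = sigma_inv (christoffel j i k).

Definition vertical_LeviCivita : Prop :=
  [/\ vertical_connection, metric & torsion_free].

Definition Cmx (i : 'I_n) : 'M[Ghat P n]_n :=
  let x := xhat P n in
  let xp := mxfrob p x in
  let qi := qhat (Pi i) q in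
  - (xp^T *m map_mx (@sigma_inv i) (map_mx (delta i) qi) *m xp)
  + map_mx (@divp p (Ghat P n))
      (mxfrob p (x^T *m map_mx (@sigma_inv i) qi *m x)
       - xp^T *m map_mx (@sigma_inv i) (mxfrob p qi) *m xp).

End Connections.

(* Main.v *)
(** The metric condition, evaluated at the entries of x, says that the Frobenius
    lift phi attached to delta^i satisfies phi(x^t q x) = (x^t q x)^(p). Writing
    phi(x) = x^(p) + p delta(x) and expanding, p (gamma + gamma^t) equals p C_i
    up to p^2; as O(G^1)^ has no p-torsion, C_ijk = gamma_ijk + gamma_ikj mod p
    after sigma_i^-1, and torsion freeness solves for gamma by the usual
    Levi-Civita permutation of indices. Modulo (p, x - 1), the second term of
    C_ijk vanishes since (x^t q x)_jk is a sum of terms x_lj q_lm x_mk all but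
    one of which lie in the ideal, and the p-th power of a sum differs from the
    sum of the p-th powers by p times mixed monomials. The maps H_q, phi_0 and
    sigma_i exist because the determinants of the prescribed images of x are
    units up to multiples of p. *)

From HB Require Import structures.
From mathcomp Require Import all_boot all_order all_algebra all_fingroup all_field.
From mathcomp Require Import boolp classical_sets.
From mathcomp Require Import generic_quotient mpoly ring.
Require Import Defs.

Set Implicit Arguments.
Unset Strict Implicit.
Unset Printing Implicit Defensive.

Import GRing.Theory.
Local Open Scope ring_scope.

(** * Ring morphisms and quotients by principal ideals *)

Lemma ring_morphismP (A B : pzRingType) (f : A -> B) :
  ring_morphism f -> exists g : {rmorphism A -> B}, f = g.
Proof.
case=> fB fM.
pose zm := GRing.isZmodMorphism.Build A B f fB.
pose mm := GRing.isMonoidMorphism.Build A B f fM.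
by exists (HB.pack_for {rmorphism A -> B} f zm mm).
Qed.

Lemma rmorph_ring_morphism (A B : pzRingType) (f : {rmorphism A -> B}) :
  ring_morphism f.
Proof. by split; [exact: raddfB | exact: rmorphism_monoidP]. Qed.

Lemma proj_eq0 (A : comPzRingType) (a x : A) :
  proj a x = 0 <-> exists z, x = a * z.
Proof.
rewrite -(rmorph0 (proj a)).
by split=> [/projP|xz]; [rewrite subr0 | apply/projP; rewrite subr0].
Qed.

Lemma pquot_lift (A B : comPzRingType) (a : A) (f : {rmorphism A -> B}) :
  f a = 0 -> exists h : {rmorphism pquot a -> B}, forall x, h (proj a x) = f x.
Proof.
move=> fa0; pose h (u : pquot a) := f (repr u).
have hE x : h (proj a x) = f x.
  have /projP[z] := repr_proj (proj a x).
  move/(congr1 f); rewrite rmorphB rmorphM fa0 mul0r => /eqP.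
  by rewrite subr_eq0 => /eqP.
suff /ring_morphismP[g hg] : ring_morphism h by exists g => x; rewrite -hg.
split=> [u v|]; last split=> [|u v].
- by rewrite -[u]repr_proj -[v]repr_proj -rmorphB /= !hE rmorphB.
- by rewrite -(rmorph1 (proj a)) hE rmorph1.
- by rewrite -[u]repr_proj -[v]repr_proj -rmorphM /= !hE rmorphM.
Qed.

(** * Torsion, units and morphisms of p-adic completions *)

Definition p_torsion_free (p : nat) (A : pzRingType) :=
  forall a : A, p%:R * a = 0 -> a = 0.

Section Completion.
Variables (A : comPzRingType) (p : nat).
Implicit Types u v : completion A p.

(** The component map gets a name of its own so that it can carry the structure of a ring
    morphism. *)
Definition residue m u : pquot (p%:R ^+ m : A) := u m.

Fact residue_zmod m : zmod_morphism (residue m). Proof. by []. Qed.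
Fact residue_monoid m : monoid_morphism (residue m). Proof. by []. Qed.
HB.instance Definition _ m :=
  GRing.isZmodMorphism.Build (completion A p) (pquot (p%:R ^+ m : A))
    (residue m) (residue_zmod m).
HB.instance Definition _ m :=
  GRing.isMonoidMorphism.Build (completion A p) (pquot (p%:R ^+ m : A))
    (residue m) (residue_monoid m).

Lemma residue_eq u v : (forall m, residue m u = residue m v) -> u = v.
Proof. exact: completion_eq. Qed.

Lemma residue_transition m u : transition (residue m.+1 u) = residue m u.
Proof. exact: componentP. Qed.

Lemma natr_pquot_eq0 m : p%:R ^+ m = 0 :> pquot (p%:R ^+ m : A).
Proof.
rewrite -(rmorph_nat (proj (p%:R ^+ m))) -rmorphXn /=.
by apply/proj_eq0; exists 1; rewrite mulr1.
Qed.

Lemma residue_succ m u : residue m u = proj _ (repr (residue m.+1 u)).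
Proof. exact/esym/residue_transition. Qed.

(** If p u = 0, a representative r of u modulo p^(m+1) has p r in p^(m+1) A, so r lies in p^m A by
    torsion freeness of A. Each level of u is thus killed by looking one level higher. *)
Lemma completion_torsion_free :
  p_torsion_free p A -> p_torsion_free p (completion A p).
Proof.
move=> Atf u pu0; apply: residue_eq => m; rewrite rmorph0 residue_succ.
have : p%:R * residue m.+1 u = 0.
  by rewrite -(rmorph_nat (residue m.+1)) -rmorphM pu0 rmorph0.
rewrite -{1}[residue _ u]repr_proj; move: (repr _) => r.
rewrite -(rmorph_nat (proj _)) -rmorphM /=.
case/proj_eq0=> z; rewrite exprS -mulrA => /eqP; rewrite -subr_eq0 -mulrBr.
move/eqP/Atf/eqP; rewrite subr_eq0 => /eqP e.
by apply/proj_eq0; exists z.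
Qed.

(** By coherence every representative r_(m+1) of u vanishes modulo p. The quotients z_m = r_(m+1) /
    p then assemble into the desired element. *)
Lemma residue1_eq0 : p_torsion_free p A ->
  forall u, residue 1 u = 0 -> exists v, u = p%:R * v.
Proof.
move=> Atf u u0.
pose r m := repr (residue m u).
have rE m : residue m u = proj _ (r m) by rewrite repr_proj.
have rS m : proj (p%:R ^+ m) (r m.+1) = proj _ (r m) by rewrite -residue_succ rE.
have /choice[z zE] m : exists z, r m.+1 = p%:R * z.
  suff: proj (p%:R ^+ 1) (r m.+1) = 0.
    by case/proj_eq0=> z ->; exists z; rewrite expr1.
  elim: m => [|m IH]; first by rewrite -rE.
  rewrite -IH; apply/projP; have /projP[w ->] := rS m.+1.
  by exists (p%:R ^+ m * w); rewrite expr1 mulrA -exprS.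
(* Dividing by p costs one power of p, whence the index shift: r_(m+2) = r_(m+1) modulo p^(m+1)
   gives z_(m+1) = z_m modulo p^m. *)
have zP m : transition (proj (p%:R ^+ m.+1) (z m.+1)) = proj (p%:R ^+ m) (z m).
  rewrite transition_proj; apply/projP.
  have /projP[w] := rS m.+1; rewrite !zE -mulrBr exprS -mulrA => /eqP.
  rewrite -subr_eq0 -mulrBr => /eqP/Atf/eqP; rewrite subr_eq0 => /eqP ->.
  by exists w.
exists (Completion zP); apply: residue_eq => m.
rewrite rmorphM rmorph_nat residue_succ -/(r _) zE rmorphM rmorph_nat.
by congr (_ * _).
Qed.

(** Inverses modulo p^m are unique, so any choice of them at each level is automatically
    coherent. *)
Lemma completion_inverse u :
  (forall m, exists b, residue m u * b = 1) -> exists v, u * v = 1.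
Proof.
move=> uV; pose b m := xget 0 [set b | residue m u * b = 1]%classic.
have bE m : residue m u * b m = 1.
  have [c uc] := uV m.
  by apply: (@xgetPex _ 0 [set b | residue m u * b = 1]%classic); exists c.
have bP m : transition (b m.+1) = b m.
  have e : residue m u * transition (b m.+1) = 1.
    by rewrite -residue_transition -transitionM bE transition_proj.
  by rewrite -[LHS]mul1r -(bE m) mulrAC e mul1r.
by exists (Completion bP); apply: residue_eq => m; rewrite rmorphM rmorph1 -(bE m).
Qed.

(** Factor u + p w = u (1 + p v w) and invert the second factor by a geometric series. *)
Lemma unit_add_pmul u v w : u * v = 1 -> exists v', (u + p%:R * w) * v' = 1.
Proof.
move=> uv1; have [m|v' v'E] := @completion_inverse (1 - p%:R * (- (v * w))).
  pose t := residue m (p%:R * (- (v * w))).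
  (* Modulo p^m the series stops after m terms, since t is a multiple of p. *)
  exists (\sum_(i < m) t ^+ i); rewrite rmorphB rmorph1 -/t.
  rewrite -opprB mulNr -subrX1 /t rmorphM rmorph_nat exprMn natr_pquot_eq0.
  by rewrite mul0r sub0r opprK.
exists (v * v'); rewrite mulrA mulrDl uv1 -[RHS]v'E; congr (_ * _).
by rewrite -mulrA mulrN opprK [w * v]mulrC.
Qed.

End Completion.

(** A ring morphism sends p^m to p^m, so f(a) modulo p^m depends only on a modulo p^m. Level m of
    the lift is therefore f of any representative at level m. *)
Lemma completion_lift (A B : comPzRingType) (p : nat)
    (f : {rmorphism A -> completion B p}) :
  exists h : {rmorphism completion A p -> completion B p},
    forall a, h (to_completion p a) = f a.
Proof.
have fE m (a b : A) :
    proj (p%:R ^+ m) a = proj _ b -> residue m (f a) = residue m (f b).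
  case/projP=> z /(canRL (subrK _)) ->.
  rewrite !rmorphD !rmorphM !rmorphXn !rmorph_nat natr_pquot_eq0.
  by rewrite mul0r add0r.
have hP (u : completion A p) m :
    transition (residue m.+1 (f (repr (residue m.+1 u)))) =
    residue m (f (repr (residue m u))).
  rewrite residue_transition; apply: fE.
  by rewrite -residue_succ repr_proj.
pose h u := Completion (hP u).
have hE u a m : residue m u = proj _ a -> residue m (h u) = residue m (f a).
  by move=> ua; apply: fE; rewrite repr_proj.
suff /ring_morphismP[g hg] : ring_morphism h.
  exists g => a; rewrite -hg; apply: residue_eq => m.
  exact: (hE (to_completion p a) a m).
split=> [u v|]; last split=> [|u v].
- apply: (@residue_eq B) => m; rewrite [RHS]rmorphB.
  rewrite (hE _ (repr (residue m u) - repr (residue m v))); first by rewrite rmorphB.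
  by rewrite !rmorphB /= !repr_proj.
- apply: (@residue_eq B) => m; rewrite -(rmorph1 f).
  by apply: (hE _ 1); rewrite rmorph1.
- apply: (@residue_eq B) => m; rewrite [RHS]rmorphM.
  rewrite (hE _ (repr (residue m u) * repr (residue m v))); first by rewrite rmorphM.
  by rewrite !rmorphM /= !repr_proj.
Qed.

(** * The Frobenius modulo p *)

Section Frobenius.
Variables (A : comPzRingType) (p : nat).
Hypothesis p_prime : prime p.

(** The factor a b is kept in the correction so that it lies in every ideal containing a or b. *)
Lemma exprD_prime (a b : A) :
  exists w, (a + b) ^+ p = a ^+ p + b ^+ p + p%:R * (a * b * w).
Proof.
case: p p_prime => [|[|m]] // pp.
rewrite exprDn big_ord_recl big_ord_recr /= [bump 0 m.+1]add1n subn0 subnn.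
rewrite !expr0 bin0 binn.
rewrite !mulr1n mulr1 mul1r.
(* Here p = m + 2, and the inner binomial terms have index i + 1. Pulling out p and a b leaves the
   coefficient C(p, i+1) / p and the monomial a^(m-i) b^i. *)
exists (\sum_(i < m.+1) (a ^+ (m - i) * b ^+ i) *+ ('C(m.+2, bump 0 i) %/ m.+2)).
rewrite -addrA; congr (_ + _); rewrite addrC; congr (_ + _).
rewrite !mulr_sumr; apply: eq_bigr => i _.
have : (m.+2 %| 'C(m.+2, bump 0 i))%N.
  by apply: prime_dvd_bin; rewrite // /bump add1n /= ltnS ltn_ord.
move/divnK; set c := (_ %/ _)%N => <-.
have im : (i <= m)%N by rewrite -ltnS.
rewrite /bump add1n subSS subSn // !exprS mulrnAr mulr_natl -mulrnA.
by congr (_ *+ _); ring.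
Qed.

Definition frob_mod (a : A) : pquot (p%:R : A) := proj _ (a ^+ p).

Lemma frob_mod_ring_morphism : ring_morphism frob_mod.
Proof.
have fD a b : frob_mod (a + b) = frob_mod a + frob_mod b.
  rewrite /frob_mod -projD; have [w ->] := exprD_prime a b.
  by apply/projP; exists (a * b * w); rewrite addrAC subrr add0r.
split=> [a b|]; last split=> [|a b].
- by apply/eqP; rewrite eq_sym subr_eq -fD subrK.
- by rewrite /frob_mod expr1n.
- by rewrite /frob_mod exprMn projM.
Qed.

(** Modulo p the p-power map is a ring morphism, hence commutes with determinants. With
    [unit_add_pmul] this will make the determinant of x^(p) a unit. *)
Lemma det_mxfrob n (y : 'M[A]_n) :
  exists w, \det (mxfrob p y) = \det y ^+ p + p%:R * w.
Proof.
have [f fE] := ring_morphismP frob_mod_ring_morphism.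
have /projP[w e] : proj p%:R (\det (mxfrob p y)) = proj p%:R (\det y ^+ p).
  rewrite -[RHS]/(frob_mod (\det y)) fE -!det_map_mx -fE; congr (\det _).
  by apply/matrixP => j k; rewrite !mxE.
by exists w; rewrite -e addrC subrK.
Qed.

(* The correction w is a combination of mixed monomials in the u i, hence lies in
   every ideal J containing the u i. *)
Lemma expr_sum_prime (I : eqType) (r : seq I) (u : I -> A) (J : A -> Prop) :
  J 0 -> (forall a b, J a -> J b -> J (a + b)) ->
  (forall a b, J b -> J (a * b)) -> (forall i, i \in r -> J (u i)) ->
  exists2 w, J w & (\sum_(i <- r) u i) ^+ p = \sum_(i <- r) u i ^+ p + p%:R * w.
Proof.
move=> J0 JD JM; elim: r => [_|i r IH Ju].
  by exists 0 => //; rewrite !big_nil mulr0 addr0 expr0n; case: p p_prime.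
have [|w Jw wE] := IH; first by move=> j jr; apply: Ju; rewrite inE jr orbT.
rewrite !big_cons; have [v ->] := exprD_prime (u i) (\sum_(j <- r) u j).
exists (w + (\sum_(j <- r) u j) * v * u i); last by rewrite wE; ring.
by apply: JD => //; apply: JM; apply: Ju; rewrite inE eqxx.
Qed.

End Frobenius.

(** * Torsion freeness of polynomial rings and their localizations *)

Lemma poly_torsion_free p (A : comNzRingType) :
  p_torsion_free p A -> p_torsion_free p {poly A}.
Proof.
move=> Atf f pf0; apply/polyP => k; rewrite coef0; apply: Atf.
have := congr1 (fun g : {poly A} => g`_k) pf0.
by rewrite mulr_natl coefMn coef0 mulr_natl.
Qed.

Lemma mpoly_torsion_free p n (A : comNzRingType) :
  p_torsion_free p A -> p_torsion_free p {mpoly A[n]}.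
Proof.
move=> Atf f pf0; apply/mpolyP => m; rewrite mcoeff0; apply: Atf.
by have := congr1 (mcoeff m) pf0; rewrite mulr_natl mcoeffMn mcoeff0 mulr_natl.
Qed.

(* Any g with p f = (d X - 1) g is divisible by p, from the constant term up. *)
Lemma localization_torsion_free p (A : comNzRingType) (d : A) :
  p_torsion_free p A -> p_torsion_free p (pquot ('X * d%:P - 1 : {poly A})).
Proof.
move=> Atf u; rewrite -[u]repr_proj; move: (repr u) => f.
rewrite -(rmorph_nat (proj _)) -rmorphM /= => /proj_eq0[g fg].
have coefg k : p%:R * f`_k = (if k == 0%N then 0 else d * g`_k.-1) - g`_k.
  rewrite mulr_natl -coefMn -mulr_natl fg mulrBl mul1r coefB; congr (_ - _).
  by rewrite -mulrA coefXM; case: k => //= k; rewrite coefCM.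
have /choice[w wE] k : exists w, g`_k = p%:R * w.
  elim: k => [|k [w wE]].
    by exists (- f`_0); rewrite mulrN coefg sub0r opprK.
  exists (d * w - f`_k.+1); rewrite mulrBr coefg /= wE; ring.
have gE : g = p%:R * \poly_(k < size g) w k.
  apply/polyP => k; rewrite mulr_natl coefMn coef_poly.
  case: ltnP => [_|gk]; first by rewrite wE mulr_natl.
  by rewrite mul0rn nth_default.
apply/proj_eq0; exists (\poly_(k < size g) w k).
have := @poly_torsion_free p A Atf (f - ('X * d%:P - 1) * \poly_(k < size g) w k).
move/(_ _)/eqP; rewrite subr_eq0 => h; apply/eqP/h.
by rewrite mulrBr mulrCA -gE fg subrr.
Qed.

(** * The rings R, R[x, 1/det x] and its completion *)

Section LocalRing.
Variables (F : splittingFieldType rat) (p : nat) (P : prime_over F p).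

Lemma natr_number_field m : (0 < m)%N -> m%:R != 0 :> F.
Proof.
move=> m0; rewrite -(rmorph_nat (in_alg F)) fmorph_eq0.
by rewrite Num.Theory.pnatr_eq0 -lt0n.
Qed.

Lemma local_ring_torsion_free : (0 < p)%N -> p_torsion_free p (local_ring P).
Proof.
move=> p0 a /(congr1 val); rewrite rmorphM rmorph_nat rmorph0 => /eqP.
rewrite mulf_eq0 (negPf (natr_number_field p0)) /= => /eqP a0.
by apply: val_inj.
Qed.

Lemma Rhat_torsion_free : (0 < p)%N -> p_torsion_free p (Rhat P).
Proof. by move=> p0; apply/completion_torsion_free/local_ring_torsion_free. Qed.

Variable n : nat.

Lemma OG_torsion_free : (0 < p)%N -> p_torsion_free p (OG P n).
Proof.
move=> p0; apply: localization_torsion_free.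
exact/mpoly_torsion_free/Rhat_torsion_free.
Qed.

Lemma Ghat_torsion_free : (0 < p)%N -> p_torsion_free p (Ghat P n).
Proof. by move=> p0; apply/completion_torsion_free/OG_torsion_free. Qed.

(** Universal property of R[x][T] / (T det x - 1): x goes to y and T to the inverse v of det y. *)
Lemma OG_lift (B : comNzRingType) (f : {rmorphism Rhat P -> B}) (y : 'M[B]_n) v :
  \det y * v = 1 ->
  exists h : {rmorphism OG P n -> B}, (forall a, h (proj _ (a%:MP)%:P) = f a) /\
    forall j k, h (proj _ (xpoly P n j k)%:P) = y j k.
Proof.
move=> yv1.
pose ev : {rmorphism {mpoly (Rhat P)[n * n]} -> B} :=
  mmap f (fun i => mxvec y 0 i).
have evX j k : ev (xpoly P n j k) = y j k.
  by rewrite mxE /ev /= mmapX mmap1U mxvecE.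
have evv : commr_rmorph ev v by move=> a; exact: mulrC.
pose h : {rmorphism _ -> B} := horner_morph evv.
have [|g gE] := @pquot_lift _ _ ('X * (\det (xpoly P n))%:P - 1) h.
  rewrite rmorphB rmorphM rmorph1 /h /= horner_morphX horner_morphC.
  rewrite -det_map_mx (_ : map_mx _ _ = y) 1?mulrC ?yv1 ?subrr //.
  by apply/matrixP => j k; rewrite [LHS]mxE evX.
exists g; split=> [a|j k]; rewrite gE /h /= horner_morphC ?evX //.
by rewrite /ev /= mmapC.
Qed.

(** Otherwise p would be invertible in R[x, 1/det x], hence in R after evaluation at x = 1; but a
    power of p vanishes at each level of R. The resulting instance lets [OG_lift] take values in
    [Ghat]. *)
Lemma Ghat_neq0 : (1 : Ghat P n) != 0.
Proof.
apply/eqP => /(congr1 (residue 1)).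
rewrite rmorph0 [residue 1 _]/= => /proj_eq0[z].
have [h _] := @OG_lift (Rhat P) idfun 1%:M 1 (etrans (mulr1 _) (det1 _ _)).
move/(congr1 h); rewrite rmorph1 rmorphM expr1 rmorph_nat => e.
have /eqP[] := Rhat_neq0 P; apply: residue_eq => m.
have -> : 1 = (p%:R * h z) ^+ m :> Rhat P by rewrite -e expr1n.
rewrite exprMn rmorphM rmorphXn rmorph_nat natr_pquot_eq0.
by rewrite mul0r rmorph0.
Qed.

HB.instance Definition _ :=
  GRing.PzSemiRing_isNonZero.Build (Ghat P n) Ghat_neq0.

End LocalRing.

Section Ghat.
Variables (F : splittingFieldType rat) (p : nat) (P : prime_over F p) (n : nat).

Definition of_poly : {rmorphism {poly {mpoly (Rhat P)[n * n]}} -> Ghat P n} :=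
  to_completion p \o proj ('X * (\det (xpoly P n))%:P - 1).

Lemma det_xhat_of_polyX : \det (xhat P n) * of_poly 'X = 1.
Proof.
have -> : xhat P n = map_mx of_poly (map_mx polyC (xpoly P n)).
  by apply/matrixP => j k; rewrite !mxE.
rewrite !det_map_mx -rmorphM -(rmorph1 of_poly) /of_poly /=.
congr (to_completion p _); apply/projP.
by exists 1; rewrite mulr1 mulrC.
Qed.

Lemma Ghat_lift (P' : prime_over F p) (f : {rmorphism Rhat P -> Ghat P' n}) y :
  (exists v, \det y * v = 1) ->
  exists h : {rmorphism Ghat P n -> Ghat P' n}, extends f y h.
Proof.
case=> v /(@OG_lift F p P n (Ghat P' n) f)[h0 [h0C h0x]].
have [h hE] := @completion_lift (OG P n) (OG P' n) p h0.
exists h; split=> [|a|]; first exact: rmorph_ring_morphism.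
  by rewrite /const hE h0C.
by apply/matrixP => j k; rewrite !mxE -/(xpoly P n) hE -h0x mxE.
Qed.

(** The polynomial is obtained by two choices of representatives: of u modulo p, then modulo T det x
    - 1. *)
Lemma of_poly_surj_mod u :
  (0 < p)%N -> exists f v, u = of_poly f + p%:R * v.
Proof.
move=> p0; have [|v uv] :=
  @residue1_eq0 _ p (OG_torsion_free p0) (u - of_poly (repr (repr (residue 1 u)))).
  rewrite rmorphB; apply/eqP; rewrite subr_eq0; apply/eqP.
  transitivity (proj (p%:R ^+ 1 : OG P n)
    (proj ('X * (\det (xpoly P n))%:P - 1) (repr (repr (residue 1 u))))) => //.
  by rewrite !repr_proj.
by exists (repr (repr (residue 1 u))), v; rewrite -uv addrC subrK.
Qed.

(** Serves to compare a lift modulo p with the p-power map. As p dies in B, an element matters only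
    through a polynomial approximating it modulo p, and no continuity argument is involved. *)
Lemma Ghat_rmorph_eq (B : comPzRingType) (g1 g2 : {rmorphism Ghat P n -> B}) :
  (0 < p)%N -> p%:R = 0 :> B -> (forall a, g1 (const n a) = g2 (const n a)) ->
  (forall j k, g1 (xhat P n j k) = g2 (xhat P n j k)) -> g1 =1 g2.
Proof.
move=> p0 Bp gC gx u.
have [f [v ->]] := of_poly_surj_mod u p0.
have ofC a : of_poly a%:MP%:P = const n a by [].
have ofx j k : of_poly (xpoly P n j k)%:P = xhat P n j k by rewrite !mxE.
have := det_xhat_of_polyX.
move: of_poly ofC ofx => c cC cx e.
rewrite !rmorphD !rmorphM !rmorph_nat Bp !mul0r {v}; congr (_ + _).
(* The images of T agree because both invert the common image of det x. *)
have gT : g1 (c 'X) = g2 (c 'X).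
  have gd : g1 (\det (xhat P n)) = g2 (\det (xhat P n)).
    rewrite -!det_map_mx; congr (\det _).
    by apply/matrixP => j k; rewrite mxE [RHS]mxE gx.
  have e1 := congr1 g1 e; have e2 := congr1 g2 e.
  rewrite !rmorphM !rmorph1 in e1 e2.
  by rewrite -[LHS]mul1r -e2 -gd mulrAC e1 mul1r.
have gm h : g1 (c h%:P) = g2 (c h%:P).
  elim/mpolyind: h => [|a m h _ _ IH]; first by rewrite !rmorph0.
  rewrite polyCD (rmorphD c) (rmorphD g1) (rmorphD g2).
  congr (_ + _); last exact: IH.
  rewrite -mul_mpolyC polyCM (rmorphM c) (rmorphM g1) (rmorphM g2) cC gC.
  congr (_ * _); rewrite mpolyXE_id !rmorph_prod; apply: eq_bigr => k _.
  rewrite !rmorphXn; congr (_ ^+ _).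
  by case/mxvec_indexP: k => j k; have := gx j k; rewrite -!cx !mxE.
elim/poly_ind: f => [|f a IH]; first by rewrite !rmorph0.
by rewrite !rmorphD !rmorphM IH gT gm.
Qed.

End Ghat.

(** * Existence of H_q, phi_0 and the inverses of sigma_i *)

Lemma det_quadratic_unit (A : comPzRingType) n (x q : 'M[A]_n) u v :
  \det x * u = 1 -> \det q * v = 1 -> exists w, \det (x^T *m q *m x) * w = 1.
Proof.
move=> xu qv; exists (u * v * u); rewrite !det_mulmx det_tr.
transitivity ((\det x * u) * (\det q * v) * (\det x * u)); first by ring.
by rewrite xu qv !mul1r.
Qed.

Section Localization.
Variables (F : splittingFieldType rat) (p : nat) (p_prime : prime p).
Implicit Types P : prime_over F p.

Lemma integral_int (m : int) : integral (m%:~R : F).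
Proof. exact: integral_id. Qed.

Lemma prime_over_intP P (m : int) : ~~ (p%:Z %| m)%Z -> ~ P m%:~R.
Proof.
move=> pm Pm; apply: (@prime1 _ _ P).
have [u [v uv]] := Bezoutz p m.
have <- : u%:~R * p%:R + v%:~R * m%:~R = 1 :> F.
  rewrite -[p%:R]/((p%:Z)%:~R) -!intrM -intrD uv.
  suff /eqP-> : coprimez p m by [].
  by rewrite coprimezE /= prime_coprime.
apply: primeD; apply: primeMl => //; try exact: integral_int.
exact: prime_above.
Qed.

Lemma in_local_quotient P (a c : F) :
  integral c -> ~ P c -> integral (c * a) -> a \in in_local P.
Proof.
move=> ic Pc ica; apply/asboolP; exists (c * a), c; split=> //.
by rewrite mulrAC divff ?mul1r ?(notP_neq0 Pc).
Qed.

Lemma integral_away_in_local P (M : int) (a : F) :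
  ~~ (p%:Z %| M)%Z -> integral_away M a -> a \in in_local P.
Proof.
move=> pM [k ia]; apply: in_local_quotient ia; rewrite -rmorphXn /=.
  exact: integral_int.
apply: prime_over_intP; move: pM; rewrite !dvdzE abszX; apply: contra.
by rewrite Euclid_dvdX // => /andP[].
Qed.

Lemma to_localK P a : a \in in_local P -> val (to_local P a) = a.
Proof. by move=> Pa; rewrite /to_local insubdK. Qed.

Lemma const_ring_morphism P n : ring_morphism (const n : Rhat P -> Ghat P n).
Proof.
exact: (rmorph_ring_morphism (of_poly P n \o polyC \o @mpolyC (n * n) (Rhat P))).
Qed.

(** The inverse is the determinant of the image of q^(-1). Since [to_local] sends elements outside
    the local ring to 0, it is not a morphism on F; the identity q q^(-1) = 1 is checked in F, where
    the entries of both matrices are known to be local. *)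
Lemma det_qhat_unit P n (q : 'M[F]_n) (M : int) :
  ~~ (p%:Z %| M)%Z -> GL_integral_away M q ->
  exists v, \det (qhat P q) * v = 1.
Proof.
move=> pM [qU qM qVM]; exists (\det (qhat P (invmx q))).
have [c cE] := ring_morphismP (const_ring_morphism P n).
pose t : {rmorphism local_ring P -> Rhat P} := to_completion p.
pose f : {rmorphism local_ring P -> Ghat P n} := c \o t.
have qhatE r : qhat P r = map_mx f (map_mx (to_local P) r).
  by apply/matrixP => j k; rewrite !mxE /= cE.
rewrite -det_mulmx !qhatE -map_mxM (_ : _ *m _ = 1%:M) ?map_mx1 ?det1 //.
apply/matrixP => j k; apply: val_inj.
have := congr1 (fun r : 'M_n => r j k) (mulmxV qU); rewrite !mxE => e.
transitivity ((j == k)%:R : F); last by rewrite rmorph_nat.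
rewrite -e rmorph_sum; apply: eq_bigr => l _.
by rewrite rmorphM /= !mxE !to_localK //; apply: (@integral_away_in_local _ M).
Qed.

Lemma halfE P n : odd p -> half n P * 2%:R = 1.
Proof.
move=> po; have [c cE] := ring_morphismP (const_ring_morphism P n).
pose t : {rmorphism local_ring P -> Rhat P} := to_completion p.
rewrite /half cE -(rmorph_nat c) -rmorphM -[RHS](rmorph1 c); congr (c _).
rewrite -(rmorph_nat t) -[to_Rhat P _]/(t (to_local P _)) -rmorphM -[RHS](rmorph1 t).
congr (t _); apply: val_inj; rewrite rmorphM rmorph_nat /= to_localK.
  by rewrite mulVf ?natr_number_field.
apply: (@in_local_quotient _ _ 2%:R); first exact: (integral_int 2).
  apply: (@prime_over_intP P 2); rewrite dvdzE /=; apply/negP => /dvdn_leq.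
  by move/(_ isT); case: p p_prime po => [|[|[|]]].
by rewrite divff ?natr_number_field //; exact: (integral_int 1).
Qed.

Lemma in_local_galV P (s : gal_of {:F}) a :
  a \in in_local (prime_image s P) -> (s^-1)%g a \in in_local P.
Proof.
move=> /asboolP[b [c [ib ic Pc ->]]]; apply/asboolP.
exists ((s^-1)%g b), ((s^-1)%g c); split; try exact: integral_gal.
  by move=> Psc; apply: Pc; exists ((s^-1)%g c); rewrite ?galV_K.
by rewrite fmorph_div.
Qed.

Lemma Rgal_morphism P P' (s : gal_of {:F}) :
  (forall a, a \in in_local P -> s a \in in_local P') ->
  ring_morphism (@Rgal F p s P P').
Proof.
(* A map found by [xget] has the defining property. The default case is refuted by constructing one:
   s restricted to the local rings, then completed. *)
move=> sP; rewrite /Rgal; case: xgetP => [h -> []//|].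
pose l (a : local_ring P) : local_ring P' := Sub (s (val a)) (sP _ (valP a)).
have /ring_morphismP[g gE] : ring_morphism l.
  split=> [a b|]; last split=> [|a b]; apply: val_inj; rewrite /= ?SubK.
  - by rewrite !rmorphB.
  - by rewrite !rmorph1.
  - by rewrite !rmorphM.
pose t : {rmorphism local_ring P' -> Rhat P'} := to_completion p.
pose tg : {rmorphism local_ring P -> Rhat P'} := t \o g.
have [h hE] := @completion_lift (local_ring P) (local_ring P') p tg.
move=> /(_ h)[]; split; first exact: rmorph_ring_morphism.
move=> a Pa; rewrite hE /tg /= -gE; congr (to_completion p _).
by apply: val_inj; rewrite /l SubK !to_localK ?sP.
Qed.

Lemma extension_extends P P' n (f : {rmorphism Rhat P -> Ghat P' n}) y :
  (exists v, \det y * v = 1) -> extends f y (extension f y).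
Proof.
move=> /(Ghat_lift f)[h hE]; rewrite /extension.
by case: xgetP => [g -> //|/(_ h)[]].
Qed.

Lemma sigma_inv_morphism n P (sigma : 'I_n -> gal_of {:F}) i :
  exists g : {rmorphism Ghat (Pi P sigma i) n -> Ghat P n},
    @sigma_inv F p n P sigma i = g /\ map_mx g (xhat (Pi P sigma i) n) = xhat P n.
Proof.
have [r rE] := ring_morphismP (Rgal_morphism (@in_local_galV P (sigma i))).
have [c cE] := ring_morphismP (const_ring_morphism P n).
pose f : {rmorphism Rhat (Pi P sigma i) -> Ghat P n} := c \o r.
have [] := @extension_extends _ _ _ f (xhat P n).
  by exists (of_poly P n 'X); exact: det_xhat_of_polyX.
have -> : extension f (xhat P n) = @sigma_inv F p n P sigma i.
  by rewrite /sigma_inv /Ggal rE cE.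
by case/ring_morphismP=> g -> _ gx; exists g.
Qed.

Lemma Hq_extends P n (q : 'M[F]_n) :
  (exists v, \det (qhat P q) * v = 1) ->
  extends (@const F p P n) ((xhat P n)^T *m qhat P q *m xhat P n) (Hq (P := P) q).
Proof.
case=> v qv; have [c cE] := ring_morphismP (const_ring_morphism P n).
rewrite /Hq cE; apply: extension_extends.
exact: det_quadratic_unit (det_xhat_of_polyX P n) qv.
Qed.

(** The determinant of x^(p) is det(x)^p up to a multiple of p, hence a unit, and the extension
    exists. It lifts Frobenius because its reduction modulo p agrees with the p-power map on
    constants and on the entries of x. *)
Lemma phi0_spec P n (d : Rhat P -> Rhat P) : pderivation p d ->
  frobenius_lift p (phi0 (n := n) d) /\
  extends (const n \o attached p d) (mxfrob p (xhat P n)) (phi0 (n := n) d).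
Proof.
case=> /ring_morphismP[a aE] _.
have [c cE] := ring_morphismP (const_ring_morphism P n).
pose f : {rmorphism Rhat P -> Ghat P n} := c \o a.
have fE : f = const n \o attached p d :> (_ -> _) by rewrite cE aE.
have [w detw] := det_mxfrob p_prime (xhat P n).
have [v dv] : exists v, \det (mxfrob p (xhat P n)) * v = 1.
  rewrite detw; apply: (@unit_add_pmul _ _ _ (of_poly P n 'X ^+ p)).
  by rewrite -exprMn det_xhat_of_polyX expr1n.
have [h hE] := Ghat_lift f (ex_intro _ v dv).
rewrite /phi0; case: xgetP => [g -> //|/(_ h)[]].
split; last by rewrite -fE.
split; first exact: rmorph_ring_morphism.
have [r rE] := ring_morphismP (frob_mod_ring_morphism (Ghat P n) p_prime).
have [_ hC hx] := hE.
pose ph : {rmorphism Ghat P n -> pquot (p%:R : Ghat P n)} := proj p%:R \o h.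
have e : ph =1 r.
  apply: Ghat_rmorph_eq; first exact: prime_gt0.
  - by rewrite -(rmorph_nat (proj _)); apply/proj_eq0; exists 1; rewrite mulr1.
  - move=> b; rewrite /ph /= hC fE -rE /frob_mod /=; apply/projP.
    exists (const n (d b)); rewrite /attached cE rmorphD rmorphXn rmorphM.
    by rewrite rmorph_nat addrAC subrr add0r.
  - move=> j k; rewrite /ph /= -rE /frob_mod; congr (proj _ _).
    by have := congr1 (fun y : 'M_n => y j k) hx; rewrite !mxE.
move=> b; have := e b; rewrite /ph -rE /frob_mod /= => /projP[z hz].
by exists z; rewrite -hz addrC subrK.
Qed.

End Localization.

(** * The ideal (p, y) and quadratic forms modulo (p, x - 1) *)

Section IdealOfMatrix.
Variables (A : comPzRingType) (p n : nat) (y : 'M[A]_n).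

Definition ideal_p_mx (a : A) := congr_p_mx p y a 0.

Lemma ideal_p_mxP a : ideal_p_mx a <->
  exists (w : A) (W : 'M[A]_n), a = p%:R * w + \sum_j \sum_k W j k * y j k.
Proof. by split=> -[w [W e]]; exists w, W; rewrite ?subr0 // -e subr0. Qed.

Lemma ideal_p_mx_congr a b : ideal_p_mx (a - b) <-> congr_p_mx p y a b.
Proof. by rewrite /ideal_p_mx /congr_p_mx subr0. Qed.

Lemma ideal_p_mx_nat w : ideal_p_mx (p%:R * w).
Proof.
apply/ideal_p_mxP; exists w, 0; rewrite big1 ?addr0 // => j _.
by rewrite big1 // => k _; rewrite mxE mul0r.
Qed.

Lemma ideal_p_mx0 : ideal_p_mx 0.
Proof. by rewrite -(mulr0 p%:R); apply: ideal_p_mx_nat. Qed.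

Lemma ideal_p_mxD a b : ideal_p_mx a -> ideal_p_mx b -> ideal_p_mx (a + b).
Proof.
move=> /ideal_p_mxP[w [W ->]] /ideal_p_mxP[v [V ->]]; apply/ideal_p_mxP.
exists (w + v), (W + V); rewrite mulrDr addrACA -big_split; congr (_ + _).
apply: eq_bigr => j _; rewrite -big_split; apply: eq_bigr => k _.
by rewrite mxE mulrDl.
Qed.

Lemma ideal_p_mxM a b : ideal_p_mx b -> ideal_p_mx (a * b).
Proof.
move=> /ideal_p_mxP[w [W ->]]; apply/ideal_p_mxP.
exists (a * w), (a *: W); rewrite mulrDr mulrCA; congr (_ + _).
rewrite mulr_sumr; apply: eq_bigr => j _; rewrite mulr_sumr.
by apply: eq_bigr => k _; rewrite mxE mulrA.
Qed.

Lemma ideal_p_mxN a : ideal_p_mx a -> ideal_p_mx (- a).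
Proof. by rewrite -mulN1r; apply: ideal_p_mxM. Qed.

Lemma ideal_p_mx_sum (I : Type) (r : seq I) (Q : pred I) (u : I -> A) :
  (forall i, Q i -> ideal_p_mx (u i)) -> ideal_p_mx (\sum_(i <- r | Q i) u i).
Proof.
by move=> Ju; elim/big_ind: _ => //; [exact: ideal_p_mx0 | exact: ideal_p_mxD].
Qed.

Lemma ideal_p_mx_entry j k : ideal_p_mx (y j k).
Proof.
apply/ideal_p_mxP; exists 0, (delta_mx j k); rewrite mulr0 add0r.
rewrite (bigD1 j) //= [X in _ + X]big1 ?addr0 => [|l lj].
  rewrite (bigD1 k) //= [X in _ + X]big1 ?addr0 => [|m mk].
    by rewrite mxE !eqxx mul1r.
  by rewrite mxE (negPf mk) andbF mul0r.
by rewrite big1 // => m _; rewrite mxE (negPf lj) mul0r.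
Qed.

End IdealOfMatrix.

(** A single sum over pairs, ready for the expansion of its p-th power. *)
Lemma quadratic_entry (A : comPzRingType) n (x q : 'M[A]_n) j k :
  (x^T *m q *m x) j k = \sum_lm x lm.1 j * q lm.1 lm.2 * x lm.2 k.
Proof.
rewrite mxE -(pair_bigA _ (fun l m => x l j * q l m * x m k)) exchange_big /=.
apply: eq_bigr => m _; rewrite mxE mulr_suml; apply: eq_bigr => l _.
by rewrite mxE.
Qed.

Section Reduction.
Variables (A : comPzRingType) (p n : nat) (p_prime : prime p).
Implicit Types (x q d : 'M[A]_n).

Lemma divpK (a : A) : p_torsion_free p A -> divp p (p%:R * a) = a.
Proof.
move=> Atf; rewrite /divp; case: xgetP => [b _ /= /eqP|/(_ a)[]//].
by rewrite -subr_eq0 -mulrBr => /eqP/Atf/eqP; rewrite subr_eq0 => /eqP.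
Qed.

Lemma mxfrob_ideal x j k :
  ideal_p_mx p (x - 1%:M) ((mxfrob p x - 1%:M) j k).
Proof.
rewrite !mxE.
(* Kronecker's delta is its own p-th power, so the entry is a difference of p-th powers, divisible
   by the difference of the bases. *)
have -> : (j == k)%:R = (j == k)%:R ^+ p :> A.
  by case: (j == k); rewrite ?expr1n // expr0n; case: p p_prime.
rewrite subrXX mulrC; apply: ideal_p_mxM.
by have := ideal_p_mx_entry p (x - 1%:M) j k; rewrite !mxE.
Qed.

(** With x = 1 + z, the difference is z^t d x + d z. The ideal is left general so that x^(p) can be
    substituted for x while keeping the ideal (p, x - 1). *)
Lemma quadratic_ideal (J : A -> Prop) x d :
  (forall a b, J a -> J b -> J (a + b)) -> (forall a b, J b -> J (a * b)) -> J 0 ->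
  (forall j k, J ((x - 1%:M) j k)) ->
  forall j k, J ((x^T *m d *m x) j k - d j k).
Proof.
move=> JD JM J0 Jx j k; set z := x - 1%:M in Jx *.
have JS (I : finType) (u : I -> A) : (forall i, J (u i)) -> J (\sum_i u i).
  by move=> Ju; elim/big_ind: _.
have zl e l m : J ((z^T *m e) l m).
  rewrite mxE; apply: JS => i; rewrite mulrC !mxE; apply: JM.
  by have := Jx i l; rewrite !mxE.
have zr e l m : J ((e *m z) l m).
  by rewrite mxE; apply: JS => i; apply: JM.
have -> : x^T *m d *m x = z^T *m (d *m x) + d *m z + d.
  have -> : x = z + 1%:M by rewrite subrK.
  rewrite [(z + _)^T]raddfD /= trmx1 !mulmxDl !mulmxDr !mul1mx !mulmx1.
  by rewrite !mulmxA !addrA.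
rewrite [X in X - _]mxE addrK [X in J X]mxE.
by apply: JD.
Qed.

(* Off the pair (j, k), every term x_lj q_lm x_mk of (x^t q x)_jk lies in the
   ideal (p, x - 1), so every mixed monomial of its p-th power does too. *)
Lemma frobenius_defect_ideal x q j k : p_torsion_free p A ->
  exists2 e, ideal_p_mx p (x - 1%:M) e &
    (x^T *m q *m x) j k ^+ p =
    ((mxfrob p x)^T *m mxfrob p q *m mxfrob p x) j k + p%:R * e.
Proof.
move=> Atf; set J := ideal_p_mx p (x - 1%:M).
rewrite !quadratic_entry.
pose u (lm : 'I_n * 'I_n) := x lm.1 j * q lm.1 lm.2 * x lm.2 k.
have -> : \sum_lm (mxfrob p x) lm.1 j * (mxfrob p q) lm.1 lm.2 * (mxfrob p x) lm.2 k
    = \sum_lm u lm ^+ p.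
  by apply: eq_bigr => lm _; rewrite !mxE !exprMn.
rewrite -/(u _) (bigD1 (j, k)) //=.
have Ju lm : lm != (j, k) -> J (u lm).
  case: lm => l m; rewrite xpair_eqE negb_and => /orP[lj|mk]; rewrite /u /=.
    rewrite -mulrA mulrC; apply: ideal_p_mxM.
    by have := ideal_p_mx_entry p (x - 1%:M) l j; rewrite !mxE (negPf lj) subr0.
  apply: ideal_p_mxM.
  by have := ideal_p_mx_entry p (x - 1%:M) m k; rewrite !mxE (negPf mk) subr0.
set S := \sum_(i | i != _) u i.
have JSum : J S by apply: ideal_p_mx_sum.
have [w ->] := exprD_prime p_prime (u (j, k)) S.
have [|v Jv Sp] := @expr_sum_prime _ _ p_prime _
    [seq lm <- index_enum _ | lm != (j, k)] u J (ideal_p_mx0 _ _)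
    (@ideal_p_mxD _ _ _ _) (@ideal_p_mxM _ _ _ _).
  by move=> lm; rewrite mem_filter => /andP[/Ju].
rewrite !big_filter -/S in Sp; exists (v + u (j, k) * w * S).
  by apply: ideal_p_mxD => //; apply: ideal_p_mxM.
by rewrite Sp [X in _ = X + _](bigD1 (j, k)) //=; ring.
Qed.

End Reduction.

(** * From the metric condition to the Christoffel symbols *)

Lemma metric_expansion (A : comPzRingType) (p n : nat) (phi : {rmorphism A -> A})
    (d : A -> A) (x r : 'M[A]_n) :
  (forall a, phi a = a ^+ p + p%:R * d a) -> r^T = r ->
  map_mx phi (x^T *m r *m x) = mxfrob p (x^T *m r *m x) ->
  let xp := mxfrob p x in
  let gamma := (map_mx d x)^T *m map_mx phi r *m xp in
  exists Z, mxfrob p (x^T *m r *m x) =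
    xp^T *m mxfrob p r *m xp +
    p%:R *: (xp^T *m map_mx d r *m xp + gamma + gamma^T + p%:R *: Z).
Proof.
move=> phiE rs <- xp gamma.
have mapE (y : 'M[A]_n) : map_mx phi y = mxfrob p y + p%:R *: map_mx d y.
  by apply/matrixP => j k; rewrite !mxE phiE.
(* Expand (x^(p) + p D)^t phi(r) (x^(p) + p D), where D is d applied to x. The witness is the
   coefficient of p^2; the cross terms are gamma and, as r is symmetric, its transpose. *)
exists ((map_mx d x)^T *m map_mx phi r *m map_mx d x).
have gammaT : gamma^T = xp^T *m map_mx phi r *m map_mx d x.
  by rewrite /gamma !trmx_mul trmxK (matrix.map_trmx phi r) rs mulmxA.
rewrite gammaT /gamma !map_mxM -(matrix.map_trmx phi x) (mapE x) -/xp.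
set D := map_mx d x.
have -> : xp^T *m mxfrob p r *m xp =
    xp^T *m map_mx phi r *m xp - p%:R *: (xp^T *m map_mx d r *m xp).
  by rewrite mapE mulmxDr mulmxDl -scalemxAr -scalemxAl addrK.
move: (map_mx phi r) => Q.
rewrite [(xp + _)^T]raddfD /= !mulmxDl !mulmxDr [(_ *: D)^T]linearZ /=.
rewrite -!scalemxAl -!scalemxAr !scalerDr !addrA.
by rewrite subrK; congr (_ + _); rewrite addrAC.
Qed.

Lemma map_mxfrob (A B : comPzRingType) (p m n : nat) (g : {rmorphism A -> B})
    (y : 'M[A]_(m, n)) :
  map_mx g (mxfrob p y) = mxfrob p (map_mx g y).
Proof. by apply/matrixP => j k; rewrite !mxE rmorphXn. Qed.

(** Transports the expansion along a ring morphism, so that all indices i can be compared in one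
    ring. *)
Lemma metric_expansion_map (A B : comPzRingType) (p n : nat)
    (phi : {rmorphism A -> A}) (g : {rmorphism A -> B})
    (d : A -> A) (x r : 'M[A]_n) (y s : 'M[B]_n) :
  (forall a, phi a = a ^+ p + p%:R * d a) -> r^T = r ->
  map_mx phi (x^T *m r *m x) = mxfrob p (x^T *m r *m x) ->
  map_mx g x = y -> map_mx g r = s ->
  let yp := mxfrob p y in
  let gamma := map_mx g ((map_mx d x)^T *m map_mx phi r *m mxfrob p x) in
  exists Z, mxfrob p (y^T *m s *m y) =
    yp^T *m mxfrob p s *m yp +
    p%:R *: (yp^T *m map_mx g (map_mx d r) *m yp + gamma + gamma^T + p%:R *: Z).
Proof.
move=> phiE rs xrx gx gr yp gamma.
have [Z] := metric_expansion phiE rs xrx; cbv zeta.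
rewrite /gamma; move: ((map_mx d x)^T *m _ *m _) => G.
move/(congr1 (map_mx g)) => e; exists (map_mx g Z); move: e.
by rewrite !(map_mxfrob, map_mxD, map_mxM, map_mxZ, rmorph_nat) -!matrix.map_trmx
  !map_mxfrob gx gr.
Qed.

(** At an entry of x, phi_0 gives its p-th power, and the ring morphism H_q turns this into the p-th
    power of the entry of x^t q x. *)
Lemma metric_equation (F : splittingFieldType rat) (p n : nat)
    (P : prime_over F p) (q : 'M[F]_n) (dR : Rhat P -> Rhat P)
    (delta : Ghat P n -> Ghat P n) :
  prime p -> (exists v, \det (qhat P q) * v = 1) -> pderivation p dR ->
  attached p delta \o Hq (P := P) q = Hq (P := P) q \o phi0 (n := n) dR ->
  let x := xhat P n in
  map_mx (attached p delta) (x^T *m qhat P q *m x) =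
  mxfrob p (x^T *m qhat P q *m x).
Proof.
move=> p_prime /Hq_extends[Hmorph _ Hx] /(phi0_spec p_prime n)[_ [_ _ px]] met x.
have [H HE] := ring_morphismP Hmorph; rewrite HE in met Hx.
apply/matrixP => j k; rewrite -Hx -/x.
have := congr1 (fun h => h (x j k)) met; rewrite /= => e.
rewrite [LHS]mxE [X in attached _ _ X]mxE e.
have := congr1 (fun y : 'M_n => y j k) px; rewrite [LHS]mxE [RHS]mxE -/x => ->.
by rewrite rmorphXn [RHS]mxE [in RHS]mxE.
Qed.

(** The same defect is divided by p in two ways: the metric expansion yields the Christoffel
    symbols, and the count of mixed monomials places the quotient in (p, x - 1). *)
Lemma defect_quotient (A : comPzRingType) (p n : nat)
    (x r s d g Z : 'M[A]_n) :
  prime p -> p_torsion_free p A -> s = mxfrob p r ->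
  let xp := mxfrob p x in
  mxfrob p (x^T *m r *m x) =
    xp^T *m mxfrob p r *m xp + p%:R *: (xp^T *m d *m xp + g + g^T + p%:R *: Z) ->
  let C := - (xp^T *m d *m xp) +
    map_mx (@divp p A) (mxfrob p (x^T *m r *m x) - xp^T *m s *m xp) in
  forall j k, C j k = g j k + g k j + p%:R * Z j k /\
    ideal_p_mx p (x - 1%:M) (C j k + d j k).
Proof.
move=> p_prime Atf -> xp e C j k.
have CE a : p%:R * a = (mxfrob p (x^T *m r *m x) - xp^T *m mxfrob p r *m xp) j k ->
    C j k = - (xp^T *m d *m xp) j k + a.
  move=> ae; rewrite /C [LHS]mxE [X in X + _]mxE [X in _ + X]mxE -ae.
  by rewrite divpK.
split.
  rewrite (CE ((xp^T *m d *m xp + g + g^T + p%:R *: Z) j k)).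
    rewrite [X in _ + X]mxE [X in _ + (X + _)]mxE [X in _ + (X + _ + _)]mxE.
    by rewrite [g^T j k]mxE [(_ *: Z) j k]mxE; ring.
  by rewrite e [in RHS]addrC [in RHS]addKr [RHS]mxE.
have [a Ja ae] := frobenius_defect_ideal p_prime x r j k Atf.
rewrite (CE a); last first.
  rewrite [RHS]mxE [X in X + _]mxE ae [X in _ = _ + X]mxE -/xp.
  by rewrite addrC addKr.
(* As x^(p) is congruent to 1, the remaining term of C reduces to -d. *)
have Jd : ideal_p_mx p (x - 1%:M) ((xp^T *m d *m xp) j k - d j k).
  apply: quadratic_ideal; [exact: ideal_p_mxD | exact: ideal_p_mxM |
    exact: ideal_p_mx0 | exact: mxfrob_ideal].
have -> : - (xp^T *m d *m xp) j k + a + d j k =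
   a + - ((xp^T *m d *m xp) j k - d j k) by ring.
by apply: ideal_p_mxD => //; apply: ideal_p_mxN.
Qed.

(** Modulo p, the combination of the C's has six symbols. Torsion freeness identifies jik with ijk,
    kij with ikj and kji with jki; four symbols cancel and twice gamma_ijk remains. Replacing C by
    -dq gives the second congruence. *)
Lemma christoffel_congruence (A : comPzRingType) (p n : nat) (y : 'M[A]_n)
    (h : A) (C : 'I_n -> 'M[A]_n) (gamma dq : 'I_n -> 'I_n -> 'I_n -> A) :
  h * 2%:R = 1 -> (forall i j k, gamma i j k = gamma j i k) ->
  (forall i, exists2 Z : 'M_n,
    forall j k, C i j k = gamma i j k + gamma i k j + p%:R * Z j k &
    forall j k, ideal_p_mx p y (C i j k + dq i j k)) ->
  forall i j k,
    congr_p p (gamma i j k) (h * (C i j k + C j i k - C k i j)) /\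
    congr_p_mx p y (gamma i j k) (- (h * (dq i j k + dq j i k - dq k i j))).
Proof.
move=> h2 tf CE i j k.
have [Zi Ci Ji] := CE i; have [Zj Cj Jj] := CE j; have [Zk Ck Jk] := CE k.
have gammaE : gamma i j k = h * (C i j k + C j i k - C k i j) +
    p%:R * - (h * (Zi j k + Zj i k - Zk i j)).
  rewrite Ci Cj Ck (tf j i k) (tf k i j) (tf k j i) -[LHS]mul1r -h2.
  by ring.
split; first by eexists; rewrite gammaE addrAC subrr add0r.
apply/ideal_p_mx_congr; rewrite gammaE opprK addrAC -mulrDr.
have -> : C i j k + C j i k - C k i j + (dq i j k + dq j i k - dq k i j) =
    (C i j k + dq i j k) + (C j i k + dq j i k) - (C k i j + dq k i j) by ring.
apply: ideal_p_mxD; last exact: ideal_p_mx_nat.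
apply: ideal_p_mxM; apply: ideal_p_mxD; last exact/ideal_p_mxN/Jk.
by apply: ideal_p_mxD; [exact: Ji | exact: Jj].
Qed.

(** * The vertical Levi-Civita connection *)

Section LeviCivita.
Variables (F : splittingFieldType rat) (M : int) (n p : nat).
Hypotheses (p_prime : prime p) (p_ndvd : ~~ (p%:Z %| M)%Z).
Variables (sigma : 'I_n -> gal_of {:F}) (P : prime_over F p) (q : 'M[F]_n).
Hypotheses (q_GL : GL_integral_away M q) (q_sym : q^T = q).
Variable dR : forall i : 'I_n, Rhat (Pi P sigma i) -> Rhat (Pi P sigma i).
Arguments dR i _ : clear implicits.
Hypothesis dR_der : forall i, pderivation p (dR i).
Variable delta : forall i : 'I_n, Ghat (Pi P sigma i) n -> Ghat (Pi P sigma i) n.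
Arguments delta i _ : clear implicits.
Hypothesis delta_LC : vertical_LeviCivita q dR delta.

Let x := xhat P n.
Let xp := mxfrob p x.

(** The first conjunct reconciles the image of q^(p), which occurs in [Cmx], with the p-th powers of
    the image of q, which the expansion produces. *)
Lemma metric_equation_sigma_inv (i : 'I_n) :
  let h := @sigma_inv F p n P sigma i in
  let qi := qhat (Pi P sigma i) q in
  let g := map_mx h (christoffel q delta i) in
  exists Z : 'M_n, map_mx h (mxfrob p qi) = mxfrob p (map_mx h qi) /\
    mxfrob p (x^T *m map_mx h qi *m x) =
      xp^T *m mxfrob p (map_mx h qi) *m xp +
      p%:R *: (xp^T *m map_mx h (map_mx (delta i) qi) *m xp +
               g + g^T + p%:R *: Z).
Proof.
case: delta_LC => conn met _; have [[deltaR _] _] := conn i.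
have qU := det_qhat_unit p_prime (Pi P sigma i) p_ndvd q_GL.
have e := metric_equation p_prime qU (dR_der i) (met i).
have [phi phiE] := ring_morphismP deltaR; rewrite phiE in e.
have phi_attached a : phi a = a ^+ p + p%:R * delta i a by rewrite -phiE.
have qs : (qhat (Pi P sigma i) q)^T = qhat (Pi P sigma i) q.
  by rewrite /qhat (matrix.map_trmx _ q) q_sym.
have [g [gE gx]] := sigma_inv_morphism P sigma i.
have [Z eZ] := metric_expansion_map phi_attached qs e gx erefl.
exists Z; rewrite gE; split; first exact: map_mxfrob.
by rewrite /christoffel phiE; exact: eZ.
Qed.

Lemma Cmx_entry i : exists2 Z : 'M_n,
  forall j k, Cmx q delta i j k = sigma_inv (christoffel q delta i j k) +
    sigma_inv (christoffel q delta i k j) + p%:R * Z j k &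
  forall j k, ideal_p_mx p (x - 1%:M)
    (Cmx q delta i j k + sigma_inv (delta i (qhat (Pi P sigma i) q j k))).
Proof.
have Gtf := Ghat_torsion_free (P := P) (n := n) (prime_gt0 p_prime).
have [Z [frobE e]] := metric_equation_sigma_inv i.
have C := defect_quotient p_prime Gtf frobE e.
exists Z => j k; have [C1 C2] := C j k.
  by rewrite [LHS]C1 mxE [X in _ + X + _]mxE.
have <- : map_mx (@sigma_inv F p n P sigma i)
    (map_mx (delta i) (qhat (Pi P sigma i) q)) j k =
    sigma_inv (delta i (qhat (Pi P sigma i) q j k)).
  by rewrite mxE [X in sigma_inv X]mxE.
exact: C2.
Qed.

End LeviCivita.

Theorem proposition2p13
    (F : splittingFieldType rat) (F_galois : galois 1 {:F})
    (M D : int) (D_disc : discriminant F D) (D_dvd : (D %| M)%Z)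
    (M_even : (2 %| M)%Z)
    (n : nat) (n_gt0 : (0 < n)%N)
    (sigma : 'I_n -> gal_of {:F}) (sigma_gauge : vertical_gauge sigma n_gt0)
    (p : nat) (p_prime : prime p) (p_ndvd : ~~ (p%:Z %| M)%Z)
    (P : prime_over F p)
    (q : 'M[F]_n) (q_GL : GL_integral_away M q) (q_sym : q^T = q)
    (dR : forall i : 'I_n, Rhat (Pi P sigma i) -> Rhat (Pi P sigma i))
    (dR_der : forall i, pderivation p (dR i))
    (delta : forall i : 'I_n, Ghat (Pi P sigma i) n -> Ghat (Pi P sigma i) n)
    (delta_LC : vertical_LeviCivita q dR delta) :
  let C := Cmx q delta in
  let gamma := fun i j k => sigma_inv (christoffel q delta i j k) in
  let s_dq := fun i j k => sigma_inv (delta i (qhat (Pi P sigma i) q j k)) in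
  forall i j k : 'I_n,
    congr_p p (gamma i j k) (half n P * (C i j k + C j i k - C k i j)) /\
    congr_p_mx p (xhat P n - 1%:M) (gamma i j k)
      (- (half n P * (s_dq i j k + s_dq j i k - s_dq k i j))).
Proof.
(* M is even and p does not divide it; oddness of p is what makes [half] an inverse of 2. *)
have p_odd : odd p.
  case: (even_prime p_prime) => // p2; move: p_ndvd M_even.
  by rewrite p2 => /negP.
apply: christoffel_congruence; first exact: halfE.
  by move=> i j k; have [_ _] := delta_LC; apply.
by move=> i; exact: (Cmx_entry p_prime p_ndvd q_GL q_sym dR_der delta_LC i).
Qed.
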